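(* Let $l \ge 1$ and $k \ge l$ be integers and $\kappa = k/l$. Consider the tiny-tasks split-merge system with $l$ workers and $k$ tasks per job, with iid exponential task service times $Q_i(n)$ with parameter $\mu>0$ and iid exponential job inter-arrival times with parameter $\lambda>0$. Let $\varrho = \lambda \kappa \mathsf{E}[Q_i(n)] = \lambda\kappa/\mu$ be the utilization of each server. Then the stability condition $\lambda\,\mathsf{E}[\Delta(n)] < 1$ holds if and only if $$\varrho < \frac{\kappa\, \mathsf{E}[Q_i(n)]}{\mathsf{E}[\Delta(n)]} = \frac{1}{1 + \frac{1}{\kappa}\sum_{i=2}^l \frac{1}{i}},$$ where $\Delta(n)$ is the service time of job $n$; that is, the maximum stable utilization is $\left(1 + \frac{1}{\kappa}\sum_{i=2}^l \frac{1}{i}\right)^{-1}$.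
   Context: Tiny-tasks split-merge system: there are $l$ identical workers (servers). Job $n \ge 1$ arrives at time $A(n)$ and consists of $k \ge l$ tasks with service times $Q_1(n),\dots,Q_k(n)$. Jobs are served one at a time in order of arrival. Job $n$ starts service at time $\max\{A(n), D(n-1)\}$, where $D(n)$ is the departure time of job $n$ and $D(0)=0$; at that instant all $l$ workers are idle. The tasks of the job are put in a FIFO task queue in the order $1,\dots,k$; the first $l$ tasks start immediately, one on each worker, and whenever a worker finishes a task it immediately fetches the head-of-line task from the queue, if any, and serves it without interruption. Job $n$ departs at the time $D(n)$ when all of its $k$ tasks have finished service. The job service time is $\Delta(n) = D(n) - \max\{A(n),D(n-1)\}$. Stability: the system is considered stable when the expected inter-arrival time exceeds the expected job service time, i.e. $1/\lambda > \mathsf{E}[\Delta(n)]$. The stability region is described by the supremum of the utilizations $\varrho$ for which this holds (the maximum stable utilization). Empty sums equal $0$. *)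

(* Defs.v *)
From mathcomp Require Import all_boot all_order all_algebra.
From mathcomp Require Import all_classical all_reals all_analysis.
Set Implicit Arguments.
Unset Strict Implicit.
Unset Printing Implicit Defensive.

Import Order.TTheory GRing.Theory Num.Theory.

Local Open Scope classical_set_scope.
Local Open Scope ring_scope.

(* Jobs and the tasks of a job are numbered from 1; values at index 0 of the
   sequences of arrival and service times are never used. *)

Section SplitMerge.
Context {R : realType}.
Variables (l k : nat) (l_gt0 : (0 < l)%N).

(* The worker that fetches the next task when i tasks have been fetched already
   and f j is the time at which worker j becomes idle. The first l tasks go to
   the l distinct workers (insub i is Some of the i-th worker iff i < l); every
   later task is fetched by the worker that finishes first. Ties do not
   influence the departure times. *)
Definition fetching_worker (f : 'I_l -> R) (i : nat) : 'I_l :=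
  odflt [arg min_(j < Ordinal l_gt0) f j]%O (insub i).

(* For a job that starts at time s and whose tasks have service times q 1,
   q 2, ..., the time at which worker j has finished those of the tasks
   1, ..., i that it has fetched (s if there are none). *)
Fixpoint idle_time (s : R) (q : nat -> R) (i : nat) : 'I_l -> R :=
  if i is i'.+1 then
    let f := idle_time s q i' in
    let w := fetching_worker f i' in
    fun j => if j == w then f w + q i'.+1 else f j
  else fun=> s.

Definition task_start (s : R) (q : nat -> R) (i : nat) : R :=
  let f := idle_time s q i.-1 in f (fetching_worker f i.-1).

Definition task_completion (s : R) (q : nat -> R) (i : nat) : R :=
  task_start s q i + q i.

(* The default value s of the maximum is immaterial: service times are
   nonnegative and k > 0. *)
Definition job_completion (s : R) (q : nat -> R) : R :=
  \big[Num.max/s]_(1 <= i < k.+1) task_completion s q i.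

(* a n is the arrival time of job n and q i n the service time of its task i. *)
Fixpoint departure (a : nat -> R) (q : nat -> nat -> R) (n : nat) : R :=
  if n is n'.+1 then
    job_completion (Num.max (a n) (departure a q n')) (q ^~ n)
  else 0.

Definition job_service_time (a : nat -> R) (q : nat -> nat -> R) (n : nat) : R :=
  departure a q n - Num.max (a n) (departure a q n.-1).

End SplitMerge.

Section Random.
Context {d : measure_display} {T : measurableType d} {R : realType}.
Variable P : probability T R.

Definition mutually_independent (I : eqType) (X : I -> T -> R) : Prop :=
  forall (J : seq I) (B : I -> set R), uniq J ->
    (forall i, measurable (B i)) ->
    P (\bigcap_(i in [set` J]) X i @^-1` B i) =
    (\prod_(i <- J) P (X i @^-1` B i))%E.

Definition iid_exponential (I : eqType) (rate : R) (X : I -> T -> R) : Prop :=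
  mutually_independent X /\
  forall i (B : set R), measurable B ->
    pushforward P (X i) B = exponential_prob rate B.

(* the time between the arrivals of jobs n and n.+1 *)
Definition interarrival (A : nat -> {RV P >-> R}) (n : nat) : T -> R :=
  A n.+1 \- A n.

Definition exponential_arrivals (lambda : R) (A : nat -> {RV P >-> R}) : Prop :=
  iid_exponential lambda (fun n : nat => interarrival A n.+1).

(* Q i n is the service time of task i of job n, for 1 <= i <= k and 1 <= n. *)
Definition exponential_tasks (k : nat) (mu : R)
    (Q : nat -> nat -> {RV P >-> R}) : Prop :=
  iid_exponential mu
    (fun x : ('I_k * nat)%type => Q x.1.+1 x.2.+1 : T -> R).

Definition Delta (l k : nat) (l_gt0 : (0 < l)%N)
    (A : nat -> {RV P >-> R}) (Q : nat -> nat -> {RV P >-> R}) (n : nat) :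
    T -> R :=
  fun t => job_service_time k l_gt0 (fun m => A m t) (fun i m => Q i m t) n.

Local Open Scope ereal_scope.

Definition stable (l k : nat) (l_gt0 : (0 < l)%N)
    (A : nat -> {RV P >-> R}) (Q : nat -> nat -> {RV P >-> R}) (n : nat) :
    Prop :=
  'E_P[Delta k l_gt0 A Q n] < 'E_P[interarrival A n].

Definition utilization (kappa lambda : R) (q : {RV P >-> R}) : \bar R :=
  lambda%:E * kappa%:E * 'E_P[q].

(* The task service times are fixed; the utilization varies through the rate
   of the arrival process. *)
Definition max_stable_utilization (l k : nat) (l_gt0 : (0 < l)%N)
    (Q : nat -> nat -> {RV P >-> R}) (i n : nat) : \bar R :=
  ereal_sup [set rho | exists (lambda : R) (A : nat -> {RV P >-> R}),
    [/\ (0 < lambda)%R, exponential_arrivals lambda A,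
        rho = utilization (k%:R / l%:R) lambda (Q i n)
      & stable k l_gt0 A Q n]].

End Random.

(* Main.v *)
From HB Require Import structures.
Require Import Defs.
From mathcomp Require Import all_boot all_order all_algebra.
From mathcomp Require Import all_classical all_reals all_analysis.
From mathcomp Require Import unstable measurable_realfun ring.
Set Implicit Arguments.
Unset Strict Implicit.
Unset Printing Implicit Defensive.

Import Order.TTheory GRing.Theory Num.Theory.
Import numFieldNormedType.Exports.

Local Open Scope classical_set_scope.
Local Open Scope ring_scope.
Local Open Scope ereal_scope.

(* The service time of a job is the makespan of list scheduling. Let V be the
   vector of the idle times of the workers. For every functional h that is
   invariant under translations, E h(V) does not change when the worker that is
   idle first receives one more exponential task: given that worker w is the
   first one, at time s, the lack of memory makes the residual times of the
   other workers and the new task again iid exponential. Hence, from the l-th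
   task on, E h(V) is the value for l iid exponential variables. For h the
   difference between the maximum and the average of V, the average being known
   because the sum of V is the total work, this yields E max(V), given that the
   maximum of l iid exponential variables has mean (1 + 1/2 + ... + 1/l) / mu. *)

(** * Exponential laws *)

(** After more than [l] tasks the idle times are in general neither independent nor exponential, so
    the lack of memory cannot be applied to them directly. The induction therefore runs on the
    functional: averaging [h] over the last task gives a functional of the earlier idle times that
    is again nonnegative and invariant under translations. The induction hypothesis moves this new
    functional to the first [l] tasks, and only there is the lack of memory invoked. All integrands
    are nonnegative with values in the extended reals, so that Tonelli's theorem applies without
    integrability. This asks for service times that are nonnegative everywhere, whereas their law
    makes them so only almost surely; the tasks are therefore replaced by their absolute values.
    Independence, which is given on products of events, is turned into the rule that one coordinate
    may be resampled under the integral. *)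

Lemma ge0_integral_law d1 d2 (X : measurableType d1) (Y : measurableType d2)
    (R : realType) (m1 : {measure set X -> \bar R}) (m2 : {measure set Y -> \bar R})
    (phi : X -> Y) (f : Y -> \bar R) :
  measurable_fun setT phi ->
  (forall B, measurable B -> m1 (phi @^-1` B) = m2 B) ->
  measurable_fun setT f -> (forall y, 0 <= f y) ->
  \int[m1]_x f (phi x) = \int[m2]_y f y.
Proof.
move=> mphi m12 mf f0.
pose mphi_mixin := isMeasurableFun.Build _ _ _ _ _ mphi.
pose g : {mfun X >-> Y} := HB.pack phi mphi_mixin.
transitivity (\int[pushforward m1 g]_(y in setT) f y).
  by rewrite ge0_integral_pushforward// => y _; exact: f0.
by apply: eq_measure_integral => B mB _; exact: m12.
Qed.

(** Open rays are closed under intersection, generate the Borel sets, and those starting at -n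
    exhaust the line; so tails determine the measure. *)
Lemma measure_eq_rays (R : realType) (m1 m2 : {measure set R -> \bar R}) :
  (forall x : R, m1 `]x, +oo[%classic < +oo) ->
  (forall x : R, m1 `]x, +oo[%classic = m2 `]x, +oo[%classic) ->
  forall B, measurable B -> m1 B = m2 B.
Proof.
move=> fin1 eq12 B mB.
apply: (measure_unique (@RGenOInfty.G R)
  (fun n => `](- n%:R)%R, +oo[%classic)) => //.
- exact: RGenOInfty.measurableE.
- move=> _ _ [x ->] [y ->]; exists (Num.max x y).
  apply/seteqP; split => z /=; rewrite !in_itv/= !andbT gt_max.
    by move=> [-> ->].
  by move=> /andP[].
- by move=> n; exists (- n%:R)%R.
- rewrite -subTset => x _; exists (Num.bound x) => //=.
  by rewrite in_itv/= andbT ltrNl ltrNbound.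
- by move=> _ [x ->].
Qed.

(** The maximum with 0 makes one formula valid on the whole line: rays starting below 0 have mass
    1. *)
Definition exponential_tail (R : realType) (rate : R) (nu : set R -> \bar R) :=
  forall x : R, nu `]x, +oo[%classic = (expR (- rate * Num.max x 0))%:E.

Section exponential_prob_tail.
Context {R : realType}.
Variable rate : R.
Hypothesis rate_gt0 : (0 < rate)%R.

Lemma expR_cvgy0 : expR (- rate * x) @[x --> +oo%R] --> (0 : R)%R.
Proof.
rewrite (_ : (fun x => expR (- rate * x)) =
             (fun z => expR (- z)) \o (fun z => rate * z)%R); last first.
  by apply: eq_fun => x; rewrite mulNr.
apply: (@cvg_comp _ _ _ _ _ _ (pinfty_nbhs R)); last exact: cvgr_expR.
exact: gt0_cvgMry.
Qed.

Lemma continuous_expRNM : continuous (fun x : R => expR (- rate * x)).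
Proof.
move=> z; apply: continuous_comp; last exact: continuous_expR.
by apply: continuousM => //; apply: (@continuousN _ R^o); exact: cst_continuous.
Qed.

Lemma exponential_prob_tail : exponential_tail rate (exponential_prob rate).
Proof.
move=> x; have [x0|x0] := lerP 0 x; last first.
  rewrite mulr0 expR0 /exponential_prob integral_mkcond.
  rewrite -(integral_exponential_pdf rate_gt0); apply: eq_integral => y _.
  rewrite patchE; case: ifPn => //; rewrite notin_setE/= in_itv/= andbT.
  move=> /negP; rewrite -leNgt => yx.
  by rewrite lt0_exponential_pdf// (le_lt_trans yx).
have xE : `[x, +oo[ `<=` `[(0 : R)%R, +oo[ by apply: subset_itvr; rewrite bnd_simp.
have mpdf : measurable_fun setT (EFin \o exponential_pdf rate).
  by apply/measurable_EFinP; exact: measurable_exponential_pdf.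
rewrite /exponential_prob integral_itv_obnd_cbnd; last exact: measurable_funTS.
rewrite (@ge0_continuous_FTC2y _ _ (fun x => - (expR (- rate * x)))%R _ 0)//.
- by rewrite EFinN oppeK add0e.
- by move=> y _; rewrite exponential_pdf_ge0// ltW.
- apply: (@continuous_subspaceW R^o _ _ [set` `[0, +oo[%R]); first exact: xE.
  exact: within_continuous_exponential_pdf.
- by rewrite -oppr0; apply: cvgN; exact: expR_cvgy0.
- by apply: cvgN; apply/cvg_at_right_filter; exact: continuous_expRNM.
- move=> y; rewrite in_itv/= andbT => xy.
  by apply: derive1_exponential_pdf; rewrite in_itv/= andbT (le_lt_trans x0).
Qed.

End exponential_prob_tail.

Section exponential_law.
Context {R : realType}.
Variables (rate : R) (nu : probability R R).
Hypothesis rate_gt0 : (0 < rate)%R.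
Hypothesis nuE : forall B, measurable B -> nu B = exponential_prob rate B.

Lemma exponential_law_tail : exponential_tail rate nu.
Proof. by move=> x; rewrite nuE// exponential_prob_tail. Qed.

Lemma exponential_law_set1 (x : R) : nu [set x] = 0.
Proof. by rewrite nuE// /exponential_prob integral_set1. Qed.

(** Restricted to the ray above [s], [nu] is its own translate by [s] scaled by [expR (- rate * s)]:
    both measures have the same tails, also for rays that start below [s]. *)
Lemma exponential_memoryless (s : R) (g : R -> \bar R) : (0 <= s)%R ->
  measurable_fun setT g -> (forall x, 0 <= g x) ->
  \int[nu]_x ((s < x)%R%:R%:E * g x) =
  (expR (- rate * s))%:E * \int[nu]_x g (s + x)%R.
Proof.
move=> s0 mg g0.
have ms : measurable_fun setT (fun x : R => s + x)%R.
  exact: measurable_funD.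
pose psh : {measure set R -> \bar R} :=
  @measure_function_pushforward__canonical__measure_function_Measure
    _ _ _ _ _ nu _ ms.
have e0 : (0 <= expR (- rate * s))%R by exact: expR_ge0.
pose c : {nonneg R} := NngNum e0.
have mrs : measurable `]s, +oo[%classic by exact: measurable_itv.
have mE : forall B : set R, measurable B ->
    mrestr nu mrs B = mscale c psh B.
  apply: measure_eq_rays => x.
    rewrite /mrestr (le_lt_trans (probability_le1 _ _)) ?ltry//.
    exact: measurableI.
  change (nu (`]x, +oo[%classic `&` `]s, +oo[%classic) =
    (expR (- rate * s))%:E * nu ((fun y => s + y)%R @^-1` `]x, +oo[%classic)).
  have -> : `]x, +oo[%classic `&` `]s, +oo[%classic = `](Num.max x s), +oo[%classic.
    apply/seteqP; split => z /=; rewrite !in_itv/= !andbT gt_max.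
      by move=> [-> ->].
    by move=> /andP[].
  have -> : (fun y => s + y)%R @^-1` `]x, +oo[%classic = `](x - s)%R, +oo[%classic.
    by apply/seteqP; split => z /=; rewrite !in_itv/= !andbT ltrBlDl.
  rewrite !exponential_law_tail -EFinM -expRD -mulrDr; congr (expR (_ * _))%:E.
  have [xs|xs] := leP x s.
    by rewrite max_l// max_r ?addr0// subr_le0.
  by rewrite !max_l ?subr_ge0 1?ltW// ?(le_lt_trans s0 xs)// addrC subrK.
transitivity (\int[nu]_(x in `]s, +oo[) g x).
  rewrite [RHS]integral_mkcond; apply: eq_integral => x _.
  rewrite patchE; case: ifPn; rewrite ?inE ?notin_setE/= in_itv/= andbT.
    by move=> ->; rewrite mul1e.
  by move=> /negP/negbTE ->; rewrite mul0e.
rewrite (eq_measure_integral (mscale c psh)); last first.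
  by move=> B mB Bs; have := mE B mB; rewrite /mrestr setIidl// => ->.
transitivity (\int[mscale c psh]_x g x).
  (* By [mE] the scaled translate has no mass outside the ray, so the domain may be enlarged to the
     whole line. *)
  rewrite -[in LHS](setCK `]s, +oo[%classic) -setTD.
  rewrite -ge0_negligible_integral//; first exact: measurableC.
  have mC : measurable (~` `]s, +oo[%classic : set R) by exact: measurableC.
  by have := mE _ mC; rewrite /mrestr setICl measure0 => ->.
rewrite ge0_integral_mscale//.
by congr (_ * _); symmetry; exact: (ge0_integral_law ms).
Qed.

(** The two indicators differ only at the point [s], which is null because the law has a density. *)
Lemma exponential_memoryless_le (s : R) (g : R -> \bar R) : (0 <= s)%R ->
  measurable_fun setT g -> (forall x, 0 <= g x) ->
  \int[nu]_x ((s <= x)%R%:R%:E * g x) =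
  (expR (- rate * s))%:E * \int[nu]_x g (s + x)%R.
Proof.
move=> s0 mg g0; rewrite -exponential_memoryless//.
have mind (P : pred R) : measurable_fun setT P ->
    measurable_fun setT (fun x => (P x)%:R%:E * g x).
  move=> mP; apply: emeasurable_funM => //; apply/measurable_EFinP.
  exact: (measurableT_comp (f := fun b : bool => b%:R : R)).
apply: ge0_ae_eq_integral => //.
- by apply: mind; apply: measurable_fun_ler.
- by apply: mind; apply: measurable_fun_ltr.
- by move=> x _; rewrite mule_ge0.
- by move=> x _; rewrite mule_ge0.
exists [set s]; split => //; first exact: exponential_law_set1.
move=> x /=; apply: contra_notP => xs _.
by rewrite lt_neqAle eq_sym; move/eqP/negbTE : xs => ->.
Qed.

End exponential_law.

(** * Laws of finite families of independent variables *)

Section function_space.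
Context {R : realType} (I : finType).

(** Boxes generate the product sigma-algebra and are closed under intersection, so they determine
    finite measures; they are also the sets on which independence computes the law. *)
Definition box : set (set (I -> R)) :=
  [set [set q | forall i, B i (q i)] | B in
    [set B : I -> set R | forall i, measurable (B i)]].

Definition funspace := g_sigma_algebraType box.

Lemma measurable_coord (i : I) : measurable_fun setT (fun q : funspace => q i).
Proof.
move=> _ B mB; rewrite setTI; apply: sub_sigma_algebra.
exists (fun j => if j == i then B else setT).
  by move=> j; case: ifP.
apply/seteqP; split => q /=.
  by move=> /(_ i); rewrite eqxx.
by move=> Bq j; case: ifPn => // /eqP ->.
Qed.

Lemma measurable_to_funspace d (T : measurableType d) (f : T -> funspace) :
  (forall i, measurable_fun setT (fun t => f t i)) -> measurable_fun setT f.
Proof.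
move=> mf; have mE := @measurability _ _ T funspace setT f box (erefl _).
apply: mE => // _ [_ [B mB <-] <-].
rewrite setTI.
have -> : f @^-1` [set q | forall i, B i (q i)] =
    \bigcap_(i in [set: I]) ((fun t => f t i) @^-1` B i).
  by apply/seteqP; split => t /= H i; [move=> _|]; apply: H.
apply: fin_bigcap_measurable => // i _; rewrite -[X in measurable X]setTI.
exact: mf.
Qed.

Definition upd (q : I -> R) (i : I) (x : R) : funspace :=
  fun j => if j == i then x else q j.

Lemma measurable_upd i :
  measurable_fun setT (fun z : funspace * R => upd z.1 i z.2).
Proof.
apply: measurable_to_funspace => j; rewrite /upd; case: eqP => _.
  exact: measurable_snd.
exact: (measurableT_comp (measurable_coord j) measurable_fst).
Qed.

Lemma funspace_law_unique (m1 m2 : {measure set funspace -> \bar R}) :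
  m1 setT < +oo ->
  (forall B : I -> set R, (forall i, measurable (B i)) ->
    m1 [set q | forall i, B i (q i)] = m2 [set q | forall i, B i (q i)]) ->
  forall A, measurable A -> m1 A = m2 A.
Proof.
move=> m1T m12 A mA.
apply: (@measure_unique _ R funspace box (fun=> setT)
  (erefl _) _ _ _ m1 m2 _ _ A mA) => //.
- move=> _ _ [B mB <-] [C mC <-]; exists (fun i => B i `&` C i).
    by move=> i; exact: measurableI.
  by apply/seteqP; split => q /= H; [split => i; have [] := H i
    | move=> i; split; apply H].
- by move=> _; exists (fun=> setT) => //; apply/seteqP; split.
- by apply/seteqP; split => // q _; exists 0%N.
- by move=> _ [B mB <-]; exact: m12.
Qed.

End function_space.
Arguments funspace R I : clear implicits.

Section resampling.
Context d {T : measurableType d} {R : realType} (P : probability T R).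
Context {I : finType} (X : I -> T -> R).
Hypothesis mX : forall i, measurable_fun setT (X i).
Hypothesis indepX : mutually_independent P X.

Definition vec (t : T) : funspace R I := X ^~ t.

Lemma measurable_vec : measurable_fun setT vec.
Proof. by apply: measurable_to_funspace => i; exact: mX. Qed.

Lemma probability_vec_box (B : I -> set R) : (forall i, measurable (B i)) ->
  P (vec @^-1` [set q | forall i, B i (q i)]) =
  \prod_(i : I) P (X i @^-1` B i).
Proof.
move=> mB; rewrite -[RHS]big_enum -indepX ?enum_uniq//.
congr (P _); apply/seteqP; split => t /= H i; first by move=> _; apply: H.
by apply: H => /=; rewrite mem_enum.
Qed.

(** Replacing one coordinate by an independent copy does not change the mass of any box, hence not
    the law of the vector. Every later use of independence in integrals over the tasks goes through
    this rule or through [probability_vec_box]. *)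
Lemma resample (nu : probability R R) (i : I) (h : funspace R I -> \bar R) :
  (forall B, measurable B -> P (X i @^-1` B) = nu B) ->
  measurable_fun setT h -> (forall q, 0 <= h q) ->
  \int[P]_t h (vec t) = \int[P]_t \int[nu]_x h (upd (vec t) i x).
Proof.
move=> Xnu mh h0.
pose Y (z : T * R) : funspace R I := upd (vec z.1) i z.2.
have mY : measurable_fun setT Y.
  apply: measurable_to_funspace => j; rewrite /Y /upd /vec; case: eqP => _.
    exact: measurable_snd.
  exact: (measurableT_comp (mX j) measurable_fst).
transitivity (\int[P \x nu]_z h (Y z)); last first.
  rewrite fubini_tonelli1//; exact: measurableT_comp.
pose law : {measure set (funspace R I) -> \bar R} :=
  @measure_function_pushforward__canonical__measure_function_Measure
    _ _ _ _ _ (P \x nu) _ mY.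
transitivity (\int[law]_q h q); last by symmetry; exact: (ge0_integral_law mY).
apply: (ge0_integral_law measurable_vec) => //.
pose law' : {measure set (funspace R I) -> \bar R} :=
  @measure_function_pushforward__canonical__measure_function_Measure
    _ _ _ _ _ P _ measurable_vec.
apply: (@funspace_law_unique _ _ law' law).
  by rewrite /law'/= /pushforward preimage_setT probability_setT ltry.
move=> B mB.
(* Coordinate [i] of the modified vector does not come from [X]: with its constraint lifted, the
   event is a rectangle in [T * R]. *)
pose C j := if j == i then setT else B j.
have mC j : measurable (C j) by rewrite /C; case: ifP.
have -> : law [set q | forall i, B i (q i)] =
    (P \x nu) ((vec @^-1` [set q | forall j, C j (q j)]) `*` B i).
  congr ((P \x nu) _); apply/seteqP; split => -[t x] /=; rewrite /Y /upd /C.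
    move=> H; split; last by have := H i; rewrite eqxx.
    by move=> j; have := H j; case: eqP.
  move=> [H Bx] j; case: eqP => [->//|/eqP ji].
  by have := H j; rewrite (negbTE ji).
rewrite product_measure1E//; last first.
  rewrite -[X in measurable X]setTI; apply: measurable_vec => //.
  by apply: sub_sigma_algebra; exists C.
change (P (vec @^-1` [set q | forall j, B j (q j)]) =
  P (vec @^-1` [set q | forall j, C j (q j)]) * nu (B i)).
rewrite (probability_vec_box mB) (probability_vec_box mC).
rewrite [LHS](bigD1 i)//= [in RHS](bigD1 i)//=.
rewrite {1}/C eqxx preimage_setT probability_setT mul1e muleC Xnu//.
congr (_ * _); apply: eq_bigr => j ji.
by rewrite /C (negbTE ji).
Qed.

End resampling.

(** * One more task for the worker that is idle first *)

Section step.
Context {R : realType} {I : finType}.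

(** Abstracts over the strict and the weak order, so that the argument below is carried out once for
    both. *)
Definition memoryless_rel (rate : R) (nu : set R -> \bar R) (r : rel R) :=
  (forall d (T : measurableType d) (f g : T -> R),
    measurable_fun setT f -> measurable_fun setT g ->
    measurable_fun setT (fun t => r (f t) (g t))) /\
  forall (s : R) (g : R -> \bar R), (0 <= s)%R ->
    measurable_fun setT g -> (forall x, 0 <= g x) ->
    \int[nu]_x ((r s x)%:R%:E * g x) =
    (expR (- rate * s))%:E * \int[nu]_x g (s + x)%R.

Definition shift_on (J : seq I) (w : I) (q : I -> R) : funspace R I :=
  fun j => if j \in J then (q w + q j)%R else q j.

Lemma measurable_shift_on J w : measurable_fun setT (shift_on J w : funspace R I -> funspace R I).
Proof.
apply: measurable_to_funspace => j; rewrite /shift_on; case: (j \in J).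
  by apply: measurable_funD; exact: measurable_coord.
exact: measurable_coord.
Qed.

Lemma shift_on_upd a J w (q : I -> R) x : a \notin J -> w \notin a :: J ->
  shift_on (a :: J) w (upd q a x) = shift_on J w (upd q a (q w + x)%R).
Proof.
move=> aJ; rewrite inE negb_or => /andP[wa wJ]; apply/funext => j.
rewrite /shift_on /upd !inE (negbTE wa); case: (j =P a) => [->|_] //=.
by rewrite (negbTE aJ).
Qed.

Lemma measurable_boolr d (T : measurableType d) (b : T -> bool) :
  measurable_fun setT b -> measurable_fun setT (fun t => (b t)%:R%:E : \bar R).
Proof.
move=> mb; apply/measurable_EFinP.
exact: (measurableT_comp (f := fun b : bool => b%:R : R)).
Qed.

End step.

Section one_step.
Context d {T : measurableType d} {R : realType} (P : probability T R).
Context {I : finType} (X : I -> T -> R).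
Variables (rate : R) (nu : probability R R).
Hypothesis mX : forall i, measurable_fun setT (X i).
Hypothesis indepX : mutually_independent P X.
Hypothesis X0 : forall i t, (0 <= X i t)%R.
Hypothesis Xnu : forall i B, measurable B -> P (X i @^-1` B) = nu B.

Let mvec := measurable_vec mX.

(** Induction on [J]: coordinate [a] is resampled on both sides, which are then compared for fixed
    other coordinates. The lack of memory at level [X w] contributes one factor
    [expR (- rate * X w)] and moves coordinate [a] up by [X w]. As [w] is not in [J], this level
    stays the same throughout. *)
Lemma shift_above (r : rel R) (J : seq I) (w : I) (psi : funspace R I -> \bar R) :
  memoryless_rel rate nu r -> uniq J -> w \notin J ->
  measurable_fun setT psi -> (forall q, 0 <= psi q) ->
  \int[P]_t ((all (fun j => r (X w t) (X j t)) J)%:R%:E * psi (vec X t)) =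
  \int[P]_t ((expR (- rate * (size J)%:R * X w t))%:E *
             psi (shift_on J w (vec X t))).
Proof.
move=> [mr memr]; elim: J psi => [|a J IH] psi /=.
  move=> _ _ mpsi psi0; apply: eq_integral => t _.
  by rewrite mulr0 mul0r expR0.
move=> /andP[aJ uJ] waJ mpsi psi0.
have /andP[wa wJ] : (w != a) && (w \notin J) by rewrite inE negb_or in waJ.
have mra : measurable_fun setT (fun q : funspace R I => (r (q w) (q a))%:R%:E : \bar R).
  by apply: measurable_boolr; apply: mr; exact: measurable_coord.
transitivity (\int[P]_t ((all (fun j => r (X w t) (X j t)) J)%:R%:E *
   ((r (vec X t w) (vec X t a))%:R%:E * psi (vec X t)))).
  apply: eq_integral => t _; rewrite muleA -EFinM -natrM mulnb andbC.
  by [].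
rewrite (IH (fun q => (r (q w) (q a))%:R%:E * psi q))//; last 2 first.
- exact: emeasurable_funM.
- by move=> q; rewrite mule_ge0.
have mexp (c : R) : measurable_fun setT
    (fun q : funspace R I => (expR (c * q w))%:E : \bar R).
  apply/measurable_EFinP; apply: measurableT_comp => //.
  by apply: measurable_funM => //; exact: measurable_coord.
have mpsis K : measurable_fun setT (fun q : funspace R I => psi (shift_on K w q)).
  by apply: measurableT_comp => //; exact: measurable_shift_on.
rewrite (resample mX indepX (i := a) (nu := nu)
  (h := fun q => (expR (- rate * (size J)%:R * q w))%:E *
    ((r (shift_on J w q w) (shift_on J w q a))%:R%:E * psi (shift_on J w q))))//;
  last 3 first.
- exact: Xnu.
- apply: emeasurable_funM => //; apply: emeasurable_funM => //.
  by apply: (measurableT_comp mra); exact: measurable_shift_on.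
- by move=> q; rewrite !mule_ge0 ?lee_fin ?expR_ge0.
rewrite (resample mX indepX (i := a) (nu := nu)
  (h := fun q => (expR (- rate * (size J).+1%:R * q w))%:E *
    psi (shift_on (a :: J) w q)))//; last 3 first.
- exact: Xnu.
- exact: emeasurable_funM.
- by move=> q; rewrite !mule_ge0 ?lee_fin ?expR_ge0.
apply: eq_integral => t _.
have updw x : upd (vec X t) a x w = X w t by rewrite /upd (negbTE wa).
have upda x : upd (vec X t) a x a = x by rewrite /upd eqxx.
have mg : measurable_fun setT (fun x : R => psi (shift_on J w (upd (vec X t) a x))).
  apply: (measurableT_comp (mpsis J)).
  by apply: measurable_to_funspace => j; rewrite /upd; case: eqP.
under eq_integral => x _.
  rewrite updw {1 2}/shift_on (negbTE wJ) (negbTE aJ) updw upda.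
  over.
under [RHS]eq_integral => x _.
  rewrite updw shift_on_upd//.
  over.
rewrite !ge0_integralZl//; last 3 first.
- apply: (measurableT_comp (mpsis J)).
  apply: measurable_to_funspace => j; rewrite /upd; case: eqP => // _.
  exact: measurable_funD.
- apply: emeasurable_funM => //; apply: measurable_boolr; exact: mr.
- by move=> x _; rewrite mule_ge0.
rewrite (memr _ (fun x => psi (shift_on J w (upd (vec X t) a x))))//.
rewrite muleA -EFinM -expRD; congr ((expR _)%:E * _).
by rewrite -[(size J).+1]addn1 natrD; ring.
Qed.

Variable sel : (I -> R) -> I.
Hypothesis sel_min : forall q j, (q (sel q) <= q j)%R.
Hypothesis msel : forall j, measurable_fun setT (fun q : funspace R I => sel q == j).

Definition shift_invariant (h : (I -> R) -> \bar R) :=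
  forall (q : I -> R) c, h (fun j => c + q j)%R = h q.

Let others w := [seq j <- enum I | j != w].

Let mem_others w j : (j \in others w) = (j != w).
Proof. by rewrite mem_filter mem_enum andbT. Qed.

Let size_others w : size (others w) = #|I|.-1.
Proof.
by rewrite -(cardC1 w) cardE /others enumT.
Qed.

(** By [shift_above] with [psi] constantly 1, this is the probability that a given coordinate is the
    first one. It is the same for all coordinates, and its value is never computed. *)
Let c := \int[nu]_x (expR (- rate * (#|I|.-1)%:R * x))%:E.

Let measurable_increment_at w (h : funspace R I -> \bar R) :
  measurable_fun setT h -> (forall q, 0 <= h q) ->
  measurable_fun setT
    (fun q : funspace R I => \int[nu]_x h (upd q w (q w + x)%R)).
Proof.
move=> mh h0.
suff mz : measurable_fun setT
    (fun z : funspace R I * R => h (upd z.1 w (z.1 w + z.2)%R)).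
  exact: (measurable_fun_fubini_tonelli_F _ mz).
apply: measurableT_comp => //; apply: measurable_to_funspace => j.
rewrite /upd; case: eqP => _; last first.
  exact: (measurableT_comp (measurable_coord j) measurable_fst).
apply: measurable_funD => //.
exact: (measurableT_comp (measurable_coord w) measurable_fst).
Qed.

Let measurable_all (r : rel R) w (J : seq I) : memoryless_rel rate nu r ->
  measurable_fun setT (fun t => all (fun j => r (X w t) (X j t)) J).
Proof.
move=> [mr _]; elim: J => [|j J IH] /=; first exact: measurable_cst.
by apply: measurable_and => //; apply: mr.
Qed.

(** After [shift_above] every coordinate contains the summand [X w]: the others by the shift, [w]
    because its new task starts then. Invariance of [h] removes it, and [X w] survives only in the
    exponential factor, which integrates to [c]. *)
Lemma integral_increment_min (r : rel R) w (h : funspace R I -> \bar R) :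
  memoryless_rel rate nu r -> measurable_fun setT h -> (forall q, 0 <= h q) ->
  shift_invariant h ->
  \int[P]_t ((all (fun j => r (X w t) (X j t)) (others w))%:R%:E *
     \int[nu]_x h (upd (vec X t) w (X w t + x)%R)) =
  c * \int[P]_t h (vec X t).
Proof.
move=> mr mh h0 hshift.
have mset : measurable_fun setT
    (fun z : funspace R I * R => h (upd z.1 w z.2)).
  by apply: measurableT_comp => //; exact: measurable_upd.
rewrite (@shift_above r (others w) w
  (fun q => \int[nu]_x h (upd q w (q w + x)%R)))//; last 4 first.
- by rewrite filter_uniq ?enum_uniq.
- by rewrite mem_others eqxx.
- exact: measurable_increment_at.
- by move=> q; apply: integral_ge0.
pose H (q : funspace R I) := \int[nu]_x h (upd q w x).
have mH : measurable_fun setT H by exact: (measurable_fun_fubini_tonelli_F _ mset).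
have H0 q : 0 <= H q by exact: integral_ge0.
have mexp : measurable_fun setT
    (fun x : R => (expR (- rate * (#|I|.-1)%:R * x))%:E : \bar R).
  by apply/measurable_EFinP; apply: measurableT_comp => //; exact: measurable_funM.
transitivity (\int[P]_t ((expR (- rate * (#|I|.-1)%:R * vec X t w))%:E *
    H (vec X t))).
  apply: eq_integral => t _; rewrite size_others; congr (_ * _).
  apply: eq_integral => x _; rewrite -(hshift (upd (vec X t) w x) (X w t)).
  congr h; apply/funext => j.
  by rewrite /upd /shift_on !mem_others eqxx/=; case: (j == w).
rewrite (resample mX indepX (i := w) (nu := nu)
  (h := fun q => (expR (- rate * (#|I|.-1)%:R * q w))%:E * H q))//; last 3 first.
- exact: Xnu.
- by apply: emeasurable_funM => //; apply: (measurableT_comp mexp); exact: measurable_coord.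
- by move=> q; rewrite mule_ge0 ?lee_fin ?expR_ge0.
(* [H] ignores coordinate [w], so the exponential factor splits off the integral. *)
have Hupd q x : H (upd q w x) = H q.
  apply: eq_integral => y _; congr h; apply/funext => j.
  by rewrite /upd; case: eqP.
transitivity (\int[P]_t (c * H (vec X t))).
  apply: eq_integral => t _.
  under eq_integral => x _.
    rewrite Hupd {1}/upd eqxx muleC.
    over.
  by rewrite ge0_integralZl// 1?muleC// => x _; rewrite lee_fin expR_ge0.
have c0 : 0 <= c by apply: integral_ge0 => x _; rewrite lee_fin expR_ge0.
rewrite ge0_integralZl//; last exact: measurableT_comp.
(* Resampling read backwards: the new task takes the place of [X w] in an iid vector. *)
congr (_ * _); symmetry; rewrite (resample mX indepX (i := w) (nu := nu))//.
exact: Xnu.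
Qed.

Definition increment (q : I -> R) (x : R) : funspace R I :=
  upd q (sel q) (q (sel q) + x)%R.

Lemma measurable_increment : measurable_fun setT (fun z : funspace R I * R => increment z.1 z.2).
Proof.
apply: measurable_to_funspace => j; rewrite /increment /upd.
have mj : measurable_fun setT (fun z : funspace R I * R => z.1 j).
  exact: (measurableT_comp (measurable_coord j) measurable_fst).
apply: (eq_measurable_fun
  (fun z : funspace R I * R => if sel z.1 == j then z.1 j + z.2 else z.1 j)%R).
  by move=> z _; rewrite eq_sym; case: eqP => // ->.
apply: measurable_fun_ifT => //; last exact: measurable_funD.
exact: (measurableT_comp (msel j) measurable_fst).
Qed.

Hypothesis rate_lt : memoryless_rel rate nu (fun x y => x < y)%R.
Hypothesis rate_le : memoryless_rel rate nu (fun x y => x <= y)%R.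

Let sum_increment (h : funspace R I -> \bar R) q : (forall q, 0 <= h q) ->
  \int[nu]_x h (increment q x) =
  \sum_w (sel q == w)%:R%:E * \int[nu]_x h (upd q w (q w + x)%R).
Proof.
move=> h0; rewrite (bigD1 (sel q))//= eqxx mul1e big1 ?adde0// => w.
by rewrite eq_sym => /negbTE ->; rewrite mul0e.
Qed.

Let measurable_increment_term (r : rel R) w (h : funspace R I -> \bar R) :
  memoryless_rel rate nu r -> measurable_fun setT h -> (forall q, 0 <= h q) ->
  measurable_fun setT (fun t =>
    (all (fun j => r (X w t) (X j t)) (others w))%:R%:E *
    \int[nu]_x h (upd (vec X t) w (X w t + x)%R)).
Proof.
move=> mr mh h0; apply: emeasurable_funM.
  by apply: measurable_boolr; exact: measurable_all.
exact: (measurableT_comp (measurable_increment_at w mh h0) mvec).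
Qed.

Let measurable_integral_increment (h : funspace R I -> \bar R) :
  measurable_fun setT h -> (forall q, 0 <= h q) ->
  measurable_fun setT (fun t => \int[nu]_x h (increment (vec X t) x)).
Proof.
move=> mh h0.
suff mz : measurable_fun setT (fun z : T * R => h (increment (vec X z.1) z.2)).
  exact: (measurable_fun_fubini_tonelli_F _ mz).
apply: measurableT_comp => //.
have mp : measurable_fun setT
    (fun z : T * R => (vec X z.1 : funspace R I, z.2)).
  apply: measurable_fun_pair => //.
  exact: (measurableT_comp mvec measurable_fst).
exact: (measurableT_comp measurable_increment mp).
Qed.

Let sum_increment_min (r : rel R) (h : funspace R I -> \bar R) :
  memoryless_rel rate nu r -> measurable_fun setT h -> (forall q, 0 <= h q) ->
  shift_invariant h ->
  \int[P]_t (\sum_w (all (fun j => r (X w t) (X j t)) (others w))%:R%:E *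
     \int[nu]_x h (upd (vec X t) w (X w t + x)%R)) =
  #|I|%:R%:E * c * \int[P]_t h (vec X t).
Proof.
move=> mr mh h0 hs; rewrite ge0_integral_sum//.
- under eq_bigr do rewrite integral_increment_min//.
  by rewrite sumr_const -muleA mule_natl.
- by move=> w; exact: measurable_increment_term.
- by move=> w t _; rewrite mule_ge0// integral_ge0.
Qed.

(* The events that w is the strict, respectively weak, minimum enclose the event
   that w is selected, so ties need not be shown to be negligible. *)
Lemma integral_increment_proportional (h : funspace R I -> \bar R) :
  measurable_fun setT h -> (forall q, 0 <= h q) -> shift_invariant h ->
  \int[P]_t \int[nu]_x h (increment (vec X t) x) =
  #|I|%:R%:E * c * \int[P]_t h (vec X t).
Proof.
move=> mh h0 hs; apply/eqP; rewrite eq_le; apply/andP; split.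
  rewrite -(sum_increment_min rate_le)//; apply: ge0_le_integral => //.
  - by move=> t _; exact: integral_ge0.
  - exact: measurable_integral_increment.
  - by apply: emeasurable_sum => w; exact: measurable_increment_term.
  move=> t _; rewrite sum_increment//; apply: lee_sum => w _.
  apply: lee_wpmul2r; first exact: integral_ge0.
  case: eqP => [<-|_]; last by rewrite lee_fin.
  rewrite lee_fin (_ : all _ _ = true)//; apply/allP => j _.
  exact: (sel_min (vec X t)).
rewrite -(sum_increment_min rate_lt)//; apply: ge0_le_integral => //.
- by move=> t _; apply: sume_ge0 => w _; rewrite mule_ge0// integral_ge0.
- by apply: emeasurable_sum => w; exact: measurable_increment_term.
- exact: measurable_integral_increment.
move=> t _; rewrite sum_increment//; apply: lee_sum => w _.
apply: lee_wpmul2r; first exact: integral_ge0.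
case: (sel _ =P w) => [_|/eqP sw]; first by rewrite lee_fin lern1 leq_b1.
rewrite (_ : all _ _ = false)//; apply/negP => /allP/(_ (sel (vec X t))).
by rewrite mem_others sw => /(_ isT); rewrite ltNge (sel_min (vec X t)).
Qed.

(* The constant of proportionality is identified with 1 by taking h = 1. *)
Lemma integral_increment (h : funspace R I -> \bar R) :
  measurable_fun setT h -> (forall q, 0 <= h q) -> shift_invariant h ->
  \int[P]_t \int[nu]_x h (increment (vec X t) x) = \int[P]_t h (vec X t).
Proof.
move=> mh h0 hs; rewrite integral_increment_proportional//.
have intc1 d' (T' : measurableType d') (m : probability T' R) :
    \int[m]_x (1 : \bar R) = 1.
  by rewrite integral_cst// mul1e; exact: probability_setT.
have := @integral_increment_proportional (cst 1) (measurable_cst _) (fun=> lee01)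
  (fun _ _ => erefl).
rewrite /cst intc1 (eq_integral (cst 1)) ?intc1 ?mule1 => [<-|t _].
  by rewrite mul1e.
by [].
Qed.

End one_step.

(** * List scheduling *)

Section scheduling.
Context {R : realType}.
Variables (l : nat) (l_gt0 : (0 < l)%N).
Implicit Types (s : R) (q : nat -> R) (v : 'I_l -> R).
Local Open Scope ring_scope.

Let w0 := Ordinal l_gt0.

Definition earliest (v : 'I_l -> R) : 'I_l := [arg min_(j < w0) v j]%O.

(** The choice depends on the idle times only through the finite table of their comparisons.
    Invariance under translations and measurability both follow from this, whatever the
    tie-breaking. *)
Definition earliest_of (g : {ffun 'I_l * 'I_l -> bool}) : 'I_l :=
  odflt w0 [pick i | [forall j, g (i, j)]].

Lemma earliestE v : earliest v = earliest_of [ffun p => v p.1 <= v p.2].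
Proof.
rewrite /earliest /earliest_of /Order.arg_min /extremum; congr odflt.
by apply: eq_pick => i /=; apply: eq_forallb => j; rewrite ffunE.
Qed.

Lemma earliest_min v j : v (earliest v) <= v j.
Proof. by rewrite /earliest; case: Order.TotalTheory.arg_minP => // i _; apply. Qed.

Lemma earliest_shift v c : earliest (fun j => c + v j) = earliest v.
Proof.
by rewrite !earliestE; congr earliest_of; apply/ffunP => p; rewrite !ffunE lerD2l.
Qed.

Lemma fetching_worker_lt v i (il : (i < l)%N) :
  fetching_worker l_gt0 v i = Ordinal il.
Proof. by rewrite /fetching_worker insubT. Qed.

Lemma fetching_worker_ge v i : (l <= i)%N ->
  fetching_worker l_gt0 v i = earliest v.
Proof. by move=> li; rewrite /fetching_worker insubN// -leqNgt. Qed.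

Lemma fetching_worker_shift v c i :
  fetching_worker l_gt0 (fun j => c + v j) i = fetching_worker l_gt0 v i.
Proof.
have [il|li] := ltnP i l; first by rewrite !fetching_worker_lt.
by rewrite !fetching_worker_ge// earliest_shift.
Qed.

Lemma idle_timeS s q i :
  idle_time l_gt0 s q i.+1 =
  upd (idle_time l_gt0 s q i) (fetching_worker l_gt0 (idle_time l_gt0 s q i) i)
    (idle_time l_gt0 s q i (fetching_worker l_gt0 (idle_time l_gt0 s q i) i) + q i.+1).
Proof. by []. Qed.

Lemma idle_time_shift s q i :
  idle_time l_gt0 s q i = fun j => s + idle_time l_gt0 0 q i j.
Proof.
elim: i => [|i IH]; first by apply/funext => j /=; rewrite addr0.
apply/funext => j /=; rewrite IH fetching_worker_shift.
by case: eqP => //= _; rewrite addrA.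
Qed.

Lemma eq_idle_time s q q' i : (forall m, (0 < m <= i)%N -> q m = q' m) ->
  idle_time l_gt0 s q i = idle_time l_gt0 s q' i.
Proof.
elim: i => //= i IH qq'; rewrite IH ?qq' ?leqnn// => m /andP[m0 mi].
by apply: qq'; rewrite m0 ltnW.
Qed.

Lemma idle_time_init q i j : (i <= l)%N ->
  idle_time l_gt0 0 q i j = if (j < i)%N then q j.+1 else 0.
Proof.
elim: i j => //= i IH j il; rewrite (fetching_worker_lt _ il) !IH ?(ltnW il)//=.
rewrite ltnn add0r ltnS -val_eqE/=.
by case: (ltngtP j i) => [||->].
Qed.

Lemma idle_time_first q j : idle_time l_gt0 0 q l j = q j.+1.
Proof. by rewrite idle_time_init// ltn_ord. Qed.

Lemma sum_idle_time q i :
  \sum_j idle_time l_gt0 0 q i j = \sum_(1 <= m < i.+1) q m.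
Proof.
elim: i => [|i IH]; first by rewrite big_geq// big1.
rewrite big_nat_recr//= -IH.
set f := idle_time _ _ _ _; set w := fetching_worker _ _ _.
rewrite (bigD1 w)//= eqxx [in RHS](bigD1 w)//= addrAC; congr (_ + _ + _).
by apply: eq_bigr => j /negbTE ->.
Qed.

Lemma idle_time_ge q i j : (forall m, (0 < m <= i)%N -> 0 <= q m) ->
  0 <= idle_time l_gt0 0 q i j.
Proof.
elim: i j => //= i IH j q0.
have q0' m : (0 < m <= i)%N -> 0 <= q m.
  by move=> /andP[m0 mi]; apply: q0; rewrite m0 ltnW.
by case: eqP => _; rewrite ?addr_ge0 ?IH// q0/=.
Qed.

(** The default is an entry of [v] rather than a constant: the value is then the true maximum for
    entries of any sign and commutes with translations. *)
Definition latest v : R := \big[Num.max/v w0]_j v j.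

Lemma latest_ge v j : v j <= latest v.
Proof. exact: le_bigmax. Qed.

Lemma latest_le v x : (forall j, v j <= x) -> latest v <= x.
Proof. by move=> vx; apply/bigmax_leP; split => // j _. Qed.

Lemma latest_shift v c : latest (fun j => c + v j) = c + latest v.
Proof.
apply/le_anti/andP; split.
  by apply: latest_le => j; rewrite lerD2l latest_ge.
rewrite -lerBrDl; apply: latest_le => j; rewrite lerBrDl.
exact: (latest_ge (fun j => c + v j)).
Qed.

Lemma latest_upd v w x : v w <= x -> latest (upd v w x) = Num.max (latest v) x.
Proof.
move=> vx; apply/le_anti/andP; split.
  apply: latest_le => j; rewrite /upd le_max; case: eqP => _.
    by rewrite lexx orbT.
  by rewrite latest_ge.
rewrite ge_max; apply/andP; split; last first.
  by have := latest_ge (upd v w x) w; rewrite /upd eqxx.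
apply: latest_le => j; apply: le_trans (latest_ge _ j).
by rewrite /upd; case: eqP => // ->.
Qed.

Lemma job_completion0 s q : job_completion 0 l_gt0 s q = s.
Proof. by rewrite /job_completion big_geq. Qed.

(* The maximum with default s is not a monoid law, so big_nat_recr is unusable. *)
Lemma job_completionS k s q : job_completion k.+1 l_gt0 s q =
  Num.max (job_completion k l_gt0 s q) (task_completion l_gt0 s q k.+1).
Proof.
have iotaS : iota 1 k.+1 = rcons (iota 1 k) k.+1.
  by rewrite -[in LHS](addn1 k) iotaD add1n cats1.
rewrite /job_completion /index_iota !subn1 !succnK iotaS.
elim: (iota 1 k) => [|a r IH] /=; first by rewrite big_cons !big_nil maxC.
by rewrite !big_cons IH maxA.
Qed.

(** A nonnegative task raises the idle time of its worker exactly to its completion time, so the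
    maximum over tasks and the one over workers grow together. *)
Lemma job_completionE k q : (forall m, (0 < m <= k)%N -> 0 <= q m) ->
  job_completion k l_gt0 0 q = latest (idle_time l_gt0 0 q k).
Proof.
elim: k => [|k IH] q0.
  rewrite job_completion0; apply/le_anti/andP; split.
    exact: (latest_ge (fun=> 0) w0).
  exact: latest_le.
rewrite job_completionS IH; last first.
  by move=> m /andP[m0 mi]; apply: q0; rewrite m0 ltnW.
by rewrite idle_timeS latest_upd ?lerDl ?q0/=.
Qed.

(** This decouples the service time of a job from arrivals and from earlier departures. *)
Lemma job_completion_shift k s q :
  job_completion k l_gt0 s q = s + job_completion k l_gt0 0 q.
Proof.
elim: k => [|k IH]; first by rewrite !job_completion0 addr0.
rewrite !job_completionS IH /task_completion /task_start/= idle_time_shift.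
by rewrite fetching_worker_shift -!addrA addr_maxr.
Qed.

Lemma eq_job_completion k s q q' : (forall m, (0 < m <= k)%N -> q m = q' m) ->
  job_completion k l_gt0 s q = job_completion k l_gt0 s q'.
Proof.
move=> qq'; rewrite /job_completion; apply: eq_big_nat => i /andP[i0 ik].
rewrite /task_completion /task_start qq' ?i0//.
rewrite (@eq_idle_time _ q q')// => m /andP[m0 mi]; apply: qq'.
by rewrite m0/= (leq_trans mi)// (leq_trans (leq_pred _)).
Qed.

End scheduling.

(** * Independent families and measurability of the schedule *)

Lemma mutually_independent_comp d (T : measurableType d) (R : realType)
    (P : probability T R) (I : eqType) (X : I -> T -> R) (g : R -> R) :
  measurable_fun setT g -> mutually_independent P X ->
  mutually_independent P (fun i t => g (X i t)).
Proof.
move=> mg indepX J B uJ mB.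
apply: (indepX J (fun i => g @^-1` B i)) => // i.
by rewrite -[X in measurable X]setTI; apply: mg.
Qed.

Lemma mutually_independent_inj d (T : measurableType d) (R : realType)
    (P : probability T R) (I : eqType) (I' : finType) (X : I -> T -> R)
    (f : I' -> I) :
  injective f -> mutually_independent P X ->
  mutually_independent P (fun i' => X (f i')).
Proof.
move=> finj indepX J B uJ mB.
(* The events are transported along [f]; indices outside its image get [setT], and injectivity makes
   the preimage unique. *)
pose B' i := odflt setT (omap B [pick i' | f i' == i]).
have B'E i' : B' (f i') = B i'.
  rewrite /B'; case: pickP => [j /eqP/finj ->//|/(_ i')].
  by rewrite eqxx.
have mB' i : measurable (B' i).
  by rewrite /B'; case: pickP => [j _|_] /=; [exact: mB|exact: measurableT].
have := indepX (map f J) B'; rewrite map_inj_uniq// big_map => /(_ uJ mB').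
under eq_bigr do rewrite B'E.
move=> <-; congr (P _); apply/seteqP; split => t /= H.
  by move=> i /= /mapP[j jJ ->] /=; rewrite B'E; exact: H.
by move=> j /= jJ; rewrite -B'E; apply: H => /=; exact: map_f.
Qed.

(** There are finitely many truth tables, and each one is realised on a finite intersection of
    measurable sets. *)
Lemma measurable_fun_ffun_bool d (T : measurableType d) (J : finType)
    (b : J -> T -> bool) (F : {ffun J -> bool} -> bool) :
  (forall j, measurable_fun setT (b j)) ->
  measurable_fun setT (fun t => F [ffun j => b j t]).
Proof.
move=> mb; apply: (measurable_fun_bool true); rewrite setTI.
have -> : (fun t => F [ffun j => b j t]) @^-1` [set true] =
    \bigcup_(g in [set g | F g]) \bigcap_(j in [set: J]) (b j @^-1` [set g j]).
  apply/seteqP; split => t /=.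
    by move=> Ft; exists [ffun j => b j t] => //= j _ /=; rewrite ffunE.
  move=> [g /= Fg bg]; rewrite -[RHS]Fg; congr F; apply/ffunP => j.
  by rewrite ffunE; exact: bg.
apply: fin_bigcup_measurable => // g _.
apply: fin_bigcap_measurable => // j _.
by rewrite -[X in measurable X]setTI; apply: mb.
Qed.

Section measurable_scheduling.
Context {R : realType}.
Variables (l : nat) (l_gt0 : (0 < l)%N).

Lemma measurable_earliest (j : 'I_l) :
  measurable_fun setT (fun v : funspace R 'I_l => earliest l_gt0 v == j).
Proof.
apply: (eq_measurable_fun (fun v : funspace R 'I_l =>
    earliest_of l_gt0 [ffun p : 'I_l * 'I_l => (v p.1 <= v p.2)%R] == j)).
  by move=> v _; rewrite earliestE.
apply: (@measurable_fun_ffun_bool _ _ ('I_l * 'I_l)%type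
  (fun p (v : funspace R 'I_l) => (v p.1 <= v p.2)%R)
  (fun g => earliest_of l_gt0 g == j)) => p.
by apply: measurable_fun_ler; exact: measurable_coord.
Qed.

Lemma measurable_latest :
  measurable_fun setT (fun v : funspace R 'I_l => latest l_gt0 v).
Proof.
rewrite /latest; elim: (index_enum _) => [|j r IH].
  apply: (eq_measurable_fun (fun v : funspace R 'I_l => v (Ordinal l_gt0))).
    by move=> v _; rewrite big_nil.
  exact: measurable_coord.
apply: (eq_measurable_fun (fun v : funspace R 'I_l =>
    Num.max (v j) (\big[Num.max/v (Ordinal l_gt0)]_(i <- r) v i))).
  by move=> v _; rewrite big_cons.
by apply: measurable_maxr => //; exact: measurable_coord.
Qed.

(* Tasks are numbered from 1: the service time of task i.+1 is q i. *)
Definition task_times k (q : 'I_k -> R) (i : nat) : R := oapp q 0%R (insub i.-1).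

Lemma task_timesS k (q : 'I_k -> R) (i : 'I_k) : task_times q i.+1 = q i.
Proof. by rewrite /task_times/= valK. Qed.

Lemma measurable_task_times k i :
  measurable_fun setT (fun q : funspace R 'I_k => task_times q i).
Proof.
rewrite /task_times; case: insub => [j|] /=; last exact: measurable_cst.
exact: measurable_coord.
Qed.

Lemma measurable_idle_time k i : measurable_fun setT
  (fun q : funspace R 'I_k => idle_time l_gt0 0 (task_times q) i : funspace R 'I_l).
Proof.
elim: i => [|i IH]; first by apply: measurable_to_funspace => j; exact: measurable_cst.
have [il|li] := ltnP i l.
  apply: measurable_to_funspace => j /=.
  apply: (eq_measurable_fun (fun q : funspace R 'I_k =>
    if j == Ordinal il then
      idle_time l_gt0 0 (task_times q) i (Ordinal il) + task_times q i.+1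
    else idle_time l_gt0 0 (task_times q) i j)%R).
    by move=> q _; rewrite fetching_worker_lt.
  case: (j == _).
    apply: measurable_funD; last exact: measurable_task_times.
    exact: (measurableT_comp (measurable_coord _) IH).
  exact: (measurableT_comp (measurable_coord _) IH).
have mp := measurable_fun_pair IH (@measurable_task_times k i.+1).
have mb := measurableT_comp (measurable_increment measurable_earliest) mp.
apply: eq_measurable_fun mb => q _.
by rewrite /= fetching_worker_ge.
Qed.

End measurable_scheduling.

(** * Invariance from the [l]-th task on *)

Section invariance.
Context d {T : measurableType d} {R : realType} (P : probability T R).
Variables (l k : nat) (l_gt0 : (0 < l)%N) (lk : (l <= k)%N).
Variables (X : 'I_k -> T -> R) (rate : R) (nu : probability R R).
Hypothesis rate_gt0 : (0 < rate)%R.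
Hypothesis nuE : forall B, measurable B -> nu B = exponential_prob rate B.
Hypothesis mX : forall i, measurable_fun setT (X i).
Hypothesis indepX : mutually_independent P X.
Hypothesis X0 : forall i t, (0 <= X i t)%R.
Hypothesis Xnu : forall i B, measurable B -> P (X i @^-1` B) = nu B.

Lemma memoryless_lt : memoryless_rel rate nu (fun x y => x < y)%R.
Proof.
split; first by move=> d' T' f g mf mg; exact: measurable_fun_ltr.
by move=> s g s0 mg g0; exact: exponential_memoryless.
Qed.

Lemma memoryless_le : memoryless_rel rate nu (fun x y => x <= y)%R.
Proof.
split; first by move=> d' T' f g mf mg; exact: measurable_fun_ler.
by move=> s g s0 mg g0; exact: exponential_memoryless_le.
Qed.

Definition first_tasks (j : 'I_l) : T -> R := X (widen_ord lk j).

Let idle i t := idle_time l_gt0 0 (task_times (vec X t)) i.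

Lemma integral_idle_time i (h : funspace R 'I_l -> \bar R) :
  (l <= i <= k)%N ->
  measurable_fun setT h -> (forall v, 0 <= h v) -> shift_invariant h ->
  \int[P]_t h (idle i t) = \int[P]_t h (vec first_tasks t).
Proof.
move=> /andP[li ik]; rewrite -(subnKC li) in ik *.
elim: (i - l)%N ik h => [|m IH] ik h mh h0 hs.
  rewrite addn0; apply: eq_integral => t _; congr h; apply/funext => j.
  rewrite /idle idle_time_first.
  by rewrite (task_timesS (vec X t) (widen_ord lk j)).
rewrite addnS in ik *; set n := (l + m)%N in ik IH *.
have mincrement := measurable_increment (@measurable_earliest R l l_gt0).
pose g (v : funspace R 'I_l) := \int[nu]_x h (increment (earliest l_gt0) v x).
have mhb : measurable_fun setT
    (fun z : funspace R 'I_l * R => h (increment (earliest l_gt0) z.1 z.2)).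
  exact: measurableT_comp.
have mg : measurable_fun setT g by exact: (measurable_fun_fubini_tonelli_F _ mhb).
have g0 v : 0 <= g v by exact: integral_ge0.
have gs : shift_invariant g.
  move=> v c; apply: eq_integral => x _; rewrite -(hs (increment _ v x) c); congr h.
  apply/funext => j; rewrite /increment /upd earliest_shift.
  by case: eqP => // _; rewrite addrA.
transitivity (\int[P]_t g (idle n t)).
  (* Task [n.+1] is coordinate [n] of the vector. The first [n] tasks do not involve it, so
     resampling it leaves [idle n] alone and averages over the last task. *)
  pose H (q : funspace R 'I_k) := h (idle_time l_gt0 0 (task_times q) n.+1).
  have mH : measurable_fun setT H.
    exact: (measurableT_comp mh (@measurable_idle_time R l l_gt0 k n.+1)).
  have H0 q : 0 <= H q by exact: h0.
  apply: (etrans (resample mX indepX (@Xnu (Ordinal ik)) mH H0)).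
  apply: eq_integral => t _; apply: eq_integral => x _; congr h.
  rewrite idle_timeS fetching_worker_ge ?leq_addr//.
  rewrite (@eq_idle_time _ _ _ _ _ (task_times (vec X t)))//; last first.
    move=> p /andP[p0 pn]; rewrite /task_times; case: insubP => //= j _ jp.
    rewrite /upd ifF//; apply/negP => /eqP/(congr1 val)/=; rewrite jp => pE.
    by move: pn; rewrite -pE; case: p p0 {jp pE} => //= p _; rewrite ltnn.
  have -> : task_times (upd (vec X t) (Ordinal ik) x) n.+1 = x.
    by rewrite (task_timesS _ (Ordinal ik)) /upd eqxx.
  by [].
(* The induction hypothesis is applied to [g] instead of [h]; what remains is one increment of an
   iid vector. *)
rewrite IH ?(ltnW ik)//.
apply: (integral_increment (rate := rate)) => //.
- by move=> j; exact: mX.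
- apply: mutually_independent_inj => // i1 i2 /(congr1 val)/= ?; exact: val_inj.
- by move=> j t; exact: X0.
- by move=> j B mB; exact: Xnu.
- exact: earliest_min.
- exact: measurable_earliest.
- exact: memoryless_lt.
- exact: memoryless_le.
Qed.

End invariance.

(** * Maximum of iid exponential variables *)

Section maximum_of_exponentials.
Context {R : realType}.
Variable rate : R.
Hypothesis rate_gt0 : (0 < rate)%R.

Let mu := @lebesgue_measure R.

Let tail (x : R) : R := expR (- rate * x).

Let tail01 x : (0 <= x)%R -> (0 <= 1 - tail x)%R.
Proof. by move=> x0; rewrite subr_ge0 /tail -expR0 ler_expR mulNr oppr_le0 mulr_ge0// ltW. Qed.

Local Open Scope ring_scope.

Lemma is_derive_power n (x : R) :
  is_derive x 1 (fun x => (rate * n.+1%:R)^-1 * (1 - tail x) ^+ n.+1)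
    ((1 - tail x) ^+ n * tail x).
Proof.
have nr0 : rate * n.+1%:R != 0 by rewrite mulf_neq0 ?gt_eqF.
have dt : is_derive x 1 tail (- rate * tail x).
  have d1 : is_derive x 1 (fun y : R => - rate * y) (- rate).
    have := @is_deriveZ R R R id (- rate) x 1 1 (is_derive_id x 1).
    by rewrite /GRing.scale/= mulr1.
  have := @is_derive1_comp R expR (fun y => - rate * y) x _ _ (is_derive_expR _) d1.
  by rewrite mulrC.
have d1 : is_derive x 1 (fun y => 1 - tail y) (rate * tail x).
  have := is_deriveB (is_derive_cst (1 : R) x 1) dt.
  by rewrite sub0r mulNr opprK.
have := @is_deriveZ R R R _ (rate * n.+1%:R)^-1 x 1 _ (is_deriveX n.+1 d1).
have -> : (fun y : R => (rate * n.+1%:R)^-1 * (1 - tail y) ^+ n.+1) =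
    (rate * n.+1%:R)^-1 \*: (fun y : R => 1 - tail y) ^+ n.+1.
  by rewrite exprfctE.
move=> dF; apply: is_derive_eq dF _.
rewrite /GRing.scale/=; field.
by rewrite addrC natr1 pnatr_eq0/= gt_eqF//.
Qed.

Local Open Scope ereal_scope.

Lemma integral_power_exponential n :
  \int[mu]_(x in `[0%R, +oo[) ((1 - tail x) ^+ n * tail x)%:E =
  ((rate * n.+1%:R)^-1)%:E.
Proof.
pose F (x : R) : R := ((rate * n.+1%:R)^-1 * (1 - tail x) ^+ n.+1)%R.
have dF := is_derive_power n.
have ctail : continuous tail := @continuous_expRNM R rate.
have cF : continuous F.
  by move=> x; apply/differentiable_continuous/derivable1_diffP; case: (dF x).
rewrite (@ge0_continuous_FTC2y _ _ F _ (rate * n.+1%:R)^-1).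
- rewrite /F /tail mulr0 expR0 subrr expr0n/= mulr0 sube0//.
- by move=> x x0; rewrite mulr_ge0 ?exprn_ge0 ?tail01// expR_ge0.
- apply: continuous_subspaceT => x.
  apply: (@continuousM _ R^o (fun y => (1 - tail y) ^+ n)%R tail);
    last exact: ctail.
  apply: (@continuous_comp _ _ _ (fun y => 1 - tail y)%R (@GRing.exp R ^~ n));
    last exact: exprn_continuous.
  by apply: continuousB; [exact: cst_continuous|exact: ctail].
- have t1 : (1 - tail x)%R @[x --> +oo%R] --> (1 - 0 : R)%R.
    by apply: cvgB; [exact: cvg_cst|exact: expR_cvgy0].
  rewrite subr0 in t1.
  have t2 : ((1 - tail x) ^+ n.+1)%R @[x --> +oo%R] --> (1 ^+ n.+1 : R)%R.
    apply: (@cvg_comp _ _ _ (fun y => 1 - tail y)%R (@GRing.exp R ^~ n.+1)).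
      exact: t1.
    exact: exprn_continuous.
  rewrite expr1n in t2.
  have := cvgMl_tmp (a := (rate * n.+1%:R)^-1%R) t2; rewrite mulr1; exact.
- by move=> x _; case: (dF x).
- by apply/cvg_at_right_filter; exact: cF.
- by move=> x _; rewrite derive1E; exact: derive_val.
Qed.

(** The integrand is the tail of the maximum of [n] variables. With u = [tail x], the geometric sum
    writes 1 - (1 - u)^n as the sum of (1 - u)^j u over j < n, and each term integrates to one
    harmonic summand. *)
Lemma integral_max_tail n :
  \int[mu]_(x in `[0%R, +oo[) (1 - (1 - tail x) ^+ n)%:E =
  (rate^-1 * \sum_(j < n) j.+1%:R^-1)%:E.
Proof.
have mtail : measurable_fun setT tail.
  by apply: measurableT_comp => //; exact: measurable_funM.
transitivity (\int[mu]_(x in `[0%R, +oo[)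
    (\sum_(j < n) ((1 - tail x) ^+ j * tail x)%:E)).
  apply: eq_integral => x _; rewrite sumEFin; congr _%:E.
  rewrite -mulr_suml -[LHS]opprB subrX1 -mulNr opprB mulrC; congr (_ * _)%R.
  by rewrite opprB addrCA subrr addr0.
rewrite ge0_integral_sum//; last 2 first.
- move=> j; apply: measurable_funTS; apply/measurable_EFinP.
  apply: measurable_funM => //; apply: measurable_funX.
  exact: measurable_funB.
- move=> j x; rewrite /= in_itv/= andbT => x0.
  by rewrite lee_fin mulr_ge0 ?exprn_ge0 ?tail01 ?expR_ge0.
under eq_bigr do rewrite integral_power_exponential.
rewrite sumEFin mulr_sumr; congr _%:E; apply: eq_bigr => j _.
by rewrite invfM.
Qed.

End maximum_of_exponentials.

Section expectation_latest.
Context d {T : measurableType d} {R : realType} (P : probability T R).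
Variables (l : nat) (l_gt0 : (0 < l)%N).
Variables (X : 'I_l -> T -> R) (rate : R) (nu : probability R R).
Hypothesis rate_gt0 : (0 < rate)%R.
Hypothesis nuE : forall B, measurable B -> nu B = exponential_prob rate B.
Hypothesis mX : forall i, measurable_fun setT (X i).
Hypothesis indepX : mutually_independent P X.
Hypothesis X0 : forall i t, (0 <= X i t)%R.
Hypothesis Xnu : forall i B, measurable B -> P (X i @^-1` B) = nu B.

(** The mean is the integral of the tail, and the event that the maximum is at most [r] is a box,
    whose probability is a product. *)
Lemma expectation_latest :
  \int[P]_t (latest l_gt0 (vec X t))%:E =
  (rate^-1 * \sum_(j < l) j.+1%:R^-1)%:E.
Proof.
pose Y t := latest l_gt0 (vec X t).
have mY : measurable_fun setT Y.
  exact: (measurableT_comp (measurable_latest l_gt0) (measurable_vec mX)).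
pose mY_mixin := isMeasurableFun.Build _ _ _ _ _ mY.
pose Z : {RV P >-> R} := HB.pack Y mY_mixin.
have Z0 t : (0 <= Z t)%R.
  exact: (le_trans (X0 (Ordinal l_gt0) t) (latest_ge l_gt0 (vec X t) _)).
transitivity ('E_P[Z]); first by rewrite expectation_def.
rewrite ge0_expectation_ccdf// -integral_max_tail//; apply: eq_integral => r.
rewrite inE/= in_itv/= andbT => r0.
pose B (j : 'I_l) := `]-oo, r]%classic : set R.
have mB j : measurable (B j) by exact: measurable_itv.
transitivity (P (~` (vec X @^-1` [set q | forall j, B j (q j)]))).
  congr (P _); apply/seteqP; split => t /=; rewrite in_itv/= andbT.
    move=> rY allB; have : (Y t <= r)%R.
      by apply: latest_le => j; have := allB j; rewrite /B/= in_itv.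
    by rewrite leNgt rY.
  move=> notB; rewrite ltNge; apply/negP => Yr; apply: notB => j.
  by rewrite /B/= in_itv/= (le_trans (latest_ge l_gt0 _ j)).
have mbox : measurable (vec X @^-1` [set q | forall j, B j (q j)]).
  rewrite -[X in measurable X]setTI; apply: (measurable_vec mX) => //.
  by apply: sub_sigma_algebra; exists B.
rewrite probability_setC// (probability_vec_box indepX mB).
have PB j : P (X j @^-1` B j) = (1 - expR (- rate * r))%:E.
  rewrite Xnu// /B -setCitvr probability_setC ?measurable_itv//.
  by rewrite (exponential_law_tail rate_gt0 nuE) max_l.
under eq_bigr do rewrite PB.
by rewrite prodEFin prodr_const card_ord -EFinB.
Qed.

End expectation_latest.

(** * Expected service time *)

Section nonnegative_tasks.
Context d {T : measurableType d} {R : realType} (P : probability T R).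
Variables (rate : R) (nu : probability R R).
Hypothesis rate_gt0 : (0 < rate)%R.
Hypothesis nuE : forall B, measurable B -> nu B = exponential_prob rate B.

(** The case of a single variable in [expectation_latest]. *)
Lemma ge0_expectation_exponential (Y : T -> R) :
  measurable_fun setT Y -> (forall t, (0 <= Y t)%R) ->
  (forall B, measurable B -> P (Y @^-1` B) = nu B) ->
  \int[P]_t (Y t)%:E = (rate^-1)%:E.
Proof.
move=> mY Y0 Ynu.
have indep1 : mutually_independent P (fun (_ : 'I_1) => Y).
  move=> [|i [|j J]] B; last by rewrite /= inE (ord1 i) (ord1 j) eqxx.
    by move=> _ _; rewrite big_nil set_nil bigcap_set0 probability_setT.
  by move=> _ _; rewrite big_seq1 set_cons1 bigcap_set1.
have := expectation_latest (ltn0Sn 0) rate_gt0 nuE (fun=> mY) indep1 (fun=> Y0) (fun=> Ynu).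
rewrite big_ord1 invr1 mulr1 => <-; apply: eq_integral => t _.
congr _%:E; apply/le_anti/andP; split.
  exact: (latest_ge _ (vec (fun=> Y) t) ord0).
exact: latest_le.
Qed.

Variables (l k : nat) (l_gt0 : (0 < l)%N) (lk : (l <= k)%N).
Variables (X : 'I_k -> T -> R).
Hypothesis mX : forall i, measurable_fun setT (X i).
Hypothesis indepX : mutually_independent P X.
Hypothesis X0 : forall i t, (0 <= X i t)%R.
Hypothesis Xnu : forall i B, measurable B -> P (X i @^-1` B) = nu B.

Let load (v : 'I_l -> R) : R := ((\sum_j v j) / l%:R)%R.

(** Besides being invariant, the difference is nonnegative, as [integral_idle_time] requires. *)
Let spread (v : 'I_l -> R) : R := (latest l_gt0 v - load v)%R.

Let spread_ge0 v : (0 <= spread v)%R.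
Proof.
rewrite subr_ge0 /load ler_pdivrMr ?ltr0n// mulr_natr.
rewrite -[X in (_ *+ X)%R]card_ord -sumr_const.
by apply: ler_sum => j _; exact: latest_ge.
Qed.

Let spread_shift v c : spread (fun j => c + v j)%R = spread v.
Proof.
have cE : (c *+ l / l%:R = c)%R.
  by rewrite -[(c *+ l)%R]mulr_natr mulfK// pnatr_eq0 -lt0n.
rewrite /spread latest_shift /load big_split/= sumr_const card_ord mulrDl cE.
by rewrite opprD addrACA subrr add0r.
Qed.

Let measurable_load : measurable_fun setT (fun v : funspace R 'I_l => load v).
Proof.
apply: measurable_funM => //.
by apply: measurable_sum => j; exact: measurable_coord.
Qed.

Let measurable_spread : measurable_fun setT (fun v : funspace R 'I_l => spread v).
Proof. by apply: measurable_funB => //; exact: measurable_latest. Qed.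

Let idle t := idle_time l_gt0 0 (task_times (vec X t)) k.

Let integral_latest (f : T -> funspace R 'I_l) :
  measurable_fun setT f -> (forall t j, (0 <= f t j)%R) ->
  \int[P]_t (latest l_gt0 (f t))%:E =
  \int[P]_t (spread (f t))%:E + \int[P]_t (load (f t))%:E.
Proof.
move=> mf f0; rewrite -ge0_integralD//.
- by apply: eq_integral => t _; rewrite -EFinD subrK.
- by move=> t _; rewrite lee_fin.
- by apply/measurable_EFinP; exact: (measurableT_comp measurable_spread).
- by move=> t _; rewrite lee_fin divr_ge0// sumr_ge0.
- by apply/measurable_EFinP; exact: (measurableT_comp measurable_load).
Qed.

Let integral_sum (I : finType) (Y : I -> T -> R) :
  (forall i, measurable_fun setT (Y i)) -> (forall i t, (0 <= Y i t)%R) ->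
  (forall i, \int[P]_t (Y i t)%:E = (rate^-1)%:E) ->
  \int[P]_t ((\sum_i Y i t) / l%:R)%:E = (#|I|%:R / l%:R / rate)%:E.
Proof.
move=> mY Y0 EY.
transitivity (\int[P]_t (\sum_i (Y i t / l%:R)%:E)).
  by apply: eq_integral => t _; rewrite sumEFin mulr_suml.
rewrite ge0_integral_sum//; last 2 first.
- by move=> i; apply/measurable_EFinP; apply: measurable_funM.
- by move=> i t _; rewrite lee_fin divr_ge0.
transitivity (\sum_(i : I) (rate^-1 / l%:R)%:E); last first.
  rewrite sumEFin sumr_const; congr _%:E.
  by rewrite -[LHS]mulr_natl mulrA mulrAC.
apply: eq_bigr => i _; rewrite EFinM -(EY i) -ge0_integralZr//.
- by apply/measurable_EFinP.
- by move=> t _; rewrite lee_fin.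
Qed.

Lemma expectation_job_completion :
  \int[P]_t (job_completion k l_gt0 0 (task_times (vec X t)))%:E =
  ((k%:R / l%:R + \sum_(2 <= j < l.+1) j%:R^-1) / rate)%:E.
Proof.
have EX i : \int[P]_t (X i t)%:E = (rate^-1)%:E.
  by apply: ge0_expectation_exponential => //; exact: Xnu.
have idle0 t j : (0 <= idle t j)%R.
  apply: idle_time_ge => m _; rewrite /task_times.
  by case: insub => //= i; exact: X0.
have midle : measurable_fun setT (idle : T -> funspace R 'I_l).
  exact: (measurableT_comp (@measurable_idle_time R l l_gt0 k k) (measurable_vec mX)).
have l0 : (l%:R != 0 :> R)%R by rewrite pnatr_eq0 -lt0n.
(* For the first [l] tasks both the maximum and the average have known means; the average has mean
   [rate^-1], finite, so it can be subtracted. *)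
have spreadE : \int[P]_t (spread (vec (first_tasks lk X) t))%:E =
    (rate^-1 * \sum_(j < l) j.+1%:R^-1 - rate^-1)%:E.
  have := integral_latest (measurable_vec (fun j => mX (widen_ord lk j)))
    (fun t j => X0 (widen_ord lk j) t).
  rewrite (expectation_latest (X := first_tasks lk X) l_gt0 rate_gt0 nuE)//; last 4 first.
  - by move=> j; exact: mX.
  - apply: mutually_independent_inj => // i1 i2 /(congr1 val)/= ?; exact: val_inj.
  - by move=> j t; exact: X0.
  - by move=> j B mB; exact: Xnu.
  rewrite [X in _ = _ + X -> _](integral_sum (Y := first_tasks lk X)); last 3 first.
  - by move=> j; exact: mX.
  - by move=> j t; exact: X0.
  - by move=> j; exact: EX.
  rewrite card_ord divff// mul1r => E.
  by rewrite EFinB E addeK.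
transitivity (\int[P]_t (latest l_gt0 (idle t))%:E).
  apply: eq_integral => t _; rewrite job_completionE// => m _.
  by rewrite /task_times; case: insub => //= i; exact: X0.
rewrite integral_latest//.
have mspread : measurable_fun setT (fun v : funspace R 'I_l => (spread v)%:E).
  by apply/measurable_EFinP; exact: measurable_spread.
have spread0 v : 0 <= (spread v)%:E by rewrite lee_fin.
have spreads : shift_invariant (fun v => (spread v)%:E).
  by move=> v c; rewrite spread_shift.
have lkk : (l <= k <= k)%N by rewrite lk leqnn.
have spread_idle := integral_idle_time l_gt0 lk rate_gt0 nuE mX indepX X0 Xnu
  lkk mspread spread0 spreads.
rewrite {}[X in X + _]spread_idle.
rewrite spreadE.
have -> : (fun t => (load (idle t))%:E) = (fun t => ((\sum_i X i t) / l%:R)%:E).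
  apply/funext => t; rewrite /load sum_idle_time; congr (_ / _)%:E.
  rewrite big_add1 big_mkord; apply: eq_bigr => i _.
  exact: task_timesS.
rewrite (integral_sum mX X0 EX) card_ord -EFinD; congr _%:E.
(* The first harmonic term cancels the subtracted [rate^-1]; this is why the final sum starts at
   2. *)
have -> : (\sum_(j < l) j.+1%:R^-1 = 1 + \sum_(2 <= j < l.+1) j%:R^-1 :> R)%R.
  rewrite -(big_mkord xpredT (fun j => (j.+1%:R^-1)%R : R)) big_ltn// invr1.
  by rewrite [in RHS]big_add1.
by field; rewrite l0 gt_eqF.
Qed.

End nonnegative_tasks.

Section exponential_law.
Context {R : realType}.
Variable rate : R.
Hypothesis rate_gt0 : (0 < rate)%R.

Let prob : probability (measurableTypeR R) R :=
  @exponential_distribution_exponential_prob__canonical__probability_measure_Probability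
    R rate rate_gt0.

Let measurable_idR :
  measurable_fun [set: measurableTypeR R] (idfun : measurableTypeR R -> R).
Proof. by move=> _ B mB; rewrite setTI preimage_id; exact: mB. Qed.

Let idR : {RV prob >-> R} :=
  HB.pack (idfun : measurableTypeR R -> R)
    (isMeasurableFun.Build _ _ _ _ _ measurable_idR).

(* exponential_prob is a probability on measurableTypeR R, whose measurable
   structure has another display than the canonical one of R. *)
Definition exponential_law : probability R R := distribution prob idR.

Lemma exponential_lawE B : exponential_law B = exponential_prob rate B.
Proof. by []. Qed.

End exponential_law.

(** * Variables with an exponential law *)

Section exponential_variables.
Context {R : realType}.
Variable rate : R.
Hypothesis rate_gt0 : (0 < rate)%R.

(** The density vanishes on the negative half-line. Hence an exponential variable may be replaced by
    its absolute value, which has the same law and is nonnegative everywhere. *)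
Lemma exponential_prob_norm (B : set R) : measurable B ->
  exponential_prob rate (Num.norm @^-1` B) = exponential_prob rate B.
Proof.
move=> mB; rewrite /exponential_prob integral_mkcond [RHS]integral_mkcond.
apply: eq_integral => x _; rewrite !patchE.
have [x0|x0] := ltP (x : R) (0 : R)%R; first by rewrite lt0_exponential_pdf//; do 2!case: ifP.
have -> : (x \in Num.norm @^-1` B) = (x \in B) by apply/idP/idP; rewrite !inE/= ger0_norm.
by [].
Qed.

Context d {T : measurableType d} (P : probability T R).
Variable Y : T -> R.
Hypothesis mY : measurable_fun setT Y.
Hypothesis lawY : forall B, measurable B -> P (Y @^-1` B) = exponential_prob rate B.

Lemma exponential_ae_norm : {ae P, forall t, `|Y t|%R = Y t}.
Proof.
exists (Y @^-1` `]-oo, 0%R[); split.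
- by rewrite -[X in measurable X]setTI; apply: mY.
- rewrite lawY// /exponential_prob; apply: integral0_eq => x.
  by rewrite /= in_itv/= => x0; rewrite lt0_exponential_pdf.
- move=> t /=; apply: contra_notP => /negP; rewrite in_itv/= -leNgt.
  exact: ger0_norm.
Qed.

Lemma norm_exponential_law B : measurable B ->
  P ((fun t => `|Y t|%R) @^-1` B) = exponential_law rate_gt0 B.
Proof.
move=> mB; rewrite -[RHS]/(exponential_prob rate B) -exponential_prob_norm//.
rewrite -lawY// -[X in measurable X]setTI.
by apply: normr_measurable.
Qed.

Lemma measurable_norm_comp : measurable_fun setT (fun t => `|Y t|%R).
Proof. exact: measurableT_comp. Qed.

Lemma expectation_exponential : 'E_P[Y] = (rate^-1)%:E.
Proof.
rewrite unlock -(ge0_expectation_exponential rate_gt0 (fun B _ => exponential_lawE rate_gt0 B)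
  measurable_norm_comp (fun t => normr_ge0 (Y t)) norm_exponential_law).
apply: ae_eq_integral => //.
- exact/measurable_EFinP.
- by apply/measurable_EFinP; exact: measurable_norm_comp.
by apply: filterS exponential_ae_norm => t -> _.
Qed.

Lemma scale_exponential_law c : (0 < c)%R ->
  forall B, measurable B ->
  P ((fun t => c * Y t)%R @^-1` B) = exponential_prob (rate / c)%R B.
Proof.
move=> c0.
have mcY : measurable_fun setT (fun t => c * Y t)%R by exact: measurable_funM.
pose m1 : {measure set R -> \bar R} :=
  @measure_function_pushforward__canonical__measure_function_Measure
    _ _ _ _ _ P _ mcY.
have rc0 : (0 < rate / c)%R by rewrite divr_gt0.
pose m2 : {measure set R -> \bar R} := exponential_law rc0.
apply: (@measure_eq_rays R m1 m2) => x.
  rewrite (le_lt_trans (probability_le1 P _)) ?ltry//.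
  by rewrite -[X in measurable X]setTI; exact: (mcY).
transitivity (P (Y @^-1` `](x / c)%R, +oo[%classic)).
  congr (P _); apply/seteqP; split => t /=; rewrite !in_itv/= !andbT.
    by rewrite ltr_pdivrMr// mulrC.
  by rewrite ltr_pdivrMr// mulrC.
rewrite lawY// exponential_prob_tail// -[RHS]/(exponential_prob (rate / c)%R _).
rewrite exponential_prob_tail//; congr (expR _)%:E.
have -> : (Num.max (x / c) 0 = Num.max x 0 / c)%R.
  by rewrite maxr_pMl ?invr_ge0 ?ltW// mul0r.
by field; rewrite gt_eqF.
Qed.

End exponential_variables.

Lemma measurable_earliest_value (R : realType) (l : nat) (l_gt0 : (0 < l)%N) :
  measurable_fun setT (fun v : funspace R 'I_l => v (earliest l_gt0 v)).
Proof.
apply: (eq_measurable_fun (fun v : funspace R 'I_l =>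
    \sum_j (if earliest l_gt0 v == j then v j else 0%R))%R).
  move=> v _; rewrite (bigD1 (earliest l_gt0 v))//= eqxx big1 ?addr0// => j.
  by rewrite eq_sym => /negbTE ->.
apply: measurable_sum => j; apply: measurable_fun_ifT => //.
  exact: measurable_earliest.
exact: measurable_coord.
Qed.

(** Shown by recursion on the number of tasks and not through [job_completionE], since the original
    service times may be negative on a null set. *)
Lemma measurable_job_completion (R : realType) (l k n : nat) (l_gt0 : (0 < l)%N) :
  measurable_fun setT (fun q : funspace R 'I_k =>
    job_completion n l_gt0 0 (task_times q)).
Proof.
elim: n => [|n IH].
  apply: (eq_measurable_fun (fun=> 0%R : R)); last exact: measurable_cst.
  by move=> q _; rewrite job_completion0.
apply: (eq_measurable_fun (fun q : funspace R 'I_k =>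
    Num.max (job_completion n l_gt0 0 (task_times q))
      (task_completion l_gt0 0 (task_times q) n.+1))).
  by move=> q _; rewrite job_completionS.
apply: measurable_maxr => //.
apply: measurable_funD; last exact: measurable_task_times.
have midle := @measurable_idle_time R l l_gt0 k n.
rewrite /task_start/=; have [nl|ln] := ltnP n l.
  apply: eq_measurable_fun (measurableT_comp (measurable_coord (Ordinal nl)) midle).
  by move=> q _; rewrite /= fetching_worker_lt.
apply: eq_measurable_fun (measurableT_comp (measurable_earliest_value l_gt0) midle).
by move=> q _; rewrite /= fetching_worker_ge.
Qed.

Section service_time.
Context d (T : measurableType d) (R : realType) (P : probability T R).
Variables (l k : nat) (l_gt0 : (0 < l)%N) (lk : (l <= k)%N).
Variables (mu : R) (mu_gt0 : (0 < mu)%R) (Q : nat -> nat -> {RV P >-> R}).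
Hypothesis hQ : exponential_tasks k mu Q.

Lemma expectation_task i n : (1 <= i <= k)%N -> (1 <= n)%N ->
  'E_P[Q i n] = (mu^-1)%:E.
Proof.
case: i n => // i [//|n] /= ik _; apply: expectation_exponential => //.
by move=> B mB; exact: (hQ.2 (Ordinal ik, n)).
Qed.

Lemma DeltaE (A : nat -> {RV P >-> R}) n : (1 <= n)%N ->
  Delta k l_gt0 A Q n = fun t => job_completion k l_gt0 0 (fun i => Q i n t).
Proof.
case: n => // n _; apply/funext => t; rewrite /Delta /job_service_time/=.
by rewrite job_completion_shift addrC addrA addNr add0r.
Qed.

Lemma expectation_Delta (A : nat -> {RV P >-> R}) n : (1 <= n)%N ->
  'E_P[Delta k l_gt0 A Q n] =
  ((k%:R / l%:R + \sum_(2 <= j < l.+1) j%:R^-1) / mu)%:E.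
Proof.
move=> n1; rewrite unlock DeltaE//; case: n n1 => // n _.
pose Y (i : 'I_k) : T -> R := Q i.+1 n.+1.
have mY i : measurable_fun setT (Y i) by [].
have lawY i B : measurable B -> P (Y i @^-1` B) = exponential_prob mu B.
  by move=> mB; exact: (hQ.2 (i, n)).
pose X (i : 'I_k) t := `|Y i t|%R.
have mX i : measurable_fun setT (X i) by exact: measurable_norm_comp.
have indepX : mutually_independent P X.
  apply: (mutually_independent_comp (X := Y)) => //.
  apply: (mutually_independent_inj (f := fun i : 'I_k => (i, n))) hQ.1.
  by move=> i j [].
rewrite -(expectation_job_completion mu_gt0
  (fun B _ => exponential_lawE mu_gt0 B) l_gt0 lk mX indepX
  (fun i t => normr_ge0 (Y i t))
  (fun i => norm_exponential_law mu_gt0 (lawY i))).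
have QE t : job_completion k l_gt0 0 (fun i => Q i n.+1 t) =
    job_completion k l_gt0 0 (task_times (vec Y t)).
  apply: eq_job_completion => -[//|i] /= ik.
  by rewrite (task_timesS _ (Ordinal ik)).
apply: ae_eq_integral => //.
- apply/measurable_EFinP; under eq_fun do rewrite QE.
  exact: (measurableT_comp (@measurable_job_completion R l k k l_gt0) (measurable_vec mY)).
- apply/measurable_EFinP.
  exact: (measurableT_comp (@measurable_job_completion R l k k l_gt0) (measurable_vec mX)).
(* The exceptional null sets are finitely many, one for each task. *)
have : {ae P, forall t, forall i, X i t = Y i t}.
  by apply: filter_forall => i; exact: exponential_ae_norm (lawY i).
apply: filterS => t XY _ /=; rewrite QE; congr _%:E.
by congr (job_completion _ _ _ (task_times _)); apply/funext => i; rewrite /vec XY.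
Qed.

End service_time.

(** * Arrival processes of arbitrary rate *)

Section arrivals.
Context d (T : measurableType d) (R : realType) (P : probability T R).
Variables (lambda : R) (lambda_gt0 : (0 < lambda)%R).
Variable A : nat -> {RV P >-> R}.
Hypothesis hA : exponential_arrivals lambda A.

Let measurable_interarrival n : measurable_fun setT (interarrival A n).
Proof. exact: measurable_funB. Qed.

Lemma expectation_interarrival n : (1 <= n)%N ->
  'E_P[interarrival A n] = (lambda^-1)%:E.
Proof.
case: n => // n _; apply: expectation_exponential => //.
by move=> B mB; exact: (hA.2 n).
Qed.

Let measurable_scaled c n : measurable_fun setT (fun t => c * A n t)%R.
Proof. exact: measurable_funM. Qed.

(** The maximum stable utilization ranges over arrival processes on the given probability space;
    rescaling time in one of them provides every rate. *)
Definition scaled_arrivals c (n : nat) : {RV P >-> R} :=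
  HB.pack (fun t => c * A n t)%R
    (isMeasurableFun.Build _ _ _ _ _ (measurable_scaled c n)).

Lemma exponential_scaled_arrivals c : (0 < c)%R ->
  exponential_arrivals (lambda / c)%R (scaled_arrivals c).
Proof.
move=> c0.
have AE n : interarrival (scaled_arrivals c) n = (fun t => c * interarrival A n t)%R.
  by apply/funext => t; rewrite /interarrival/= mulrBr.
split.
  under [X in mutually_independent P X]eq_fun do rewrite AE.
  apply: (mutually_independent_comp (X := fun n => interarrival A n.+1)); last exact: hA.1.
  exact: measurable_funM.
move=> n B mB; rewrite AE.
by apply: scale_exponential_law => // B' mB'; exact: (hA.2 n).
Qed.

End arrivals.

Theorem mainTheorem2 (R : realType) (d : measure_display) (T : measurableType d)
    (P : probability T R) (l k : nat) (l_gt0 : (0 < l)%N) (lk : (l <= k)%N)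
    (lambda mu : R) (lambda_gt0 : (0 < lambda)%R) (mu_gt0 : (0 < mu)%R)
    (A : nat -> {RV P >-> R}) (Q : nat -> nat -> {RV P >-> R})
    (hA : exponential_arrivals lambda A) (hQ : exponential_tasks k mu Q)
    (i n : nat) (hi : (1 <= i <= k)%N) (hn : (1 <= n)%N) :
  let kappa : R := (k%:R / l%:R)%R in
  let rho := utilization kappa lambda (Q i n) in
  let EDelta := 'E_P[Delta k l_gt0 A Q n] in
  let bound : R := ((1 + kappa^-1 * \sum_(2 <= j < l.+1) j%:R^-1)^-1)%R in
  [/\ rho = (lambda * kappa / mu)%:E,
      stable k l_gt0 A Q n <-> lambda%:E * EDelta < 1,
      lambda%:E * EDelta < 1 <-> rho < kappa%:E * 'E_P[Q i n] / EDelta,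
      kappa%:E * 'E_P[Q i n] / EDelta = bound%:E
    & max_stable_utilization k l_gt0 Q i n = bound%:E].
Proof.
move=> kappa rho EDelta.
set S := (\sum_(2 <= j < l.+1) j%:R^-1 : R)%R; move=> bound.
pose D := ((kappa + S) / mu)%R.
have kappa_gt0 : (0 < kappa)%R by rewrite divr_gt0 ?ltr0n// (leq_trans l_gt0).
have S_ge0 : (0 <= S)%R by apply: sumr_ge0 => j _; rewrite invr_ge0 ler0n.
have kS_gt0 : (0 < kappa + S)%R by rewrite ltr_pwDl.
have D_gt0 : (0 < D)%R by rewrite divr_gt0.
have EQ : 'E_P[Q i n] = (mu^-1)%:E by exact: (expectation_task mu_gt0 hQ).
(* The mean service time is the same for all arrival processes [B], as the supremum needs. *)
have EDE B : 'E_P[Delta k l_gt0 B Q n] = D%:E.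
  exact: (expectation_Delta l_gt0 lk mu_gt0 hQ).
have utilE r : utilization kappa r (Q i n) = (r * kappa / mu)%:E.
  by rewrite /utilization EQ -!EFinM.
have boundE : (bound = kappa / mu / D)%R.
  rewrite /bound /D; field.
  by rewrite !gt_eqF//= ?mulr_gt0 ?addr_gt0.
have stableE r B : (0 < r)%R -> exponential_arrivals r B ->
    stable k l_gt0 B Q n <-> (r * D < 1)%R.
  move=> r0 hB; rewrite /stable EDE (expectation_interarrival r0 hB)// lte_fin.
  by rewrite -[X in (_ < X)%R]mul1r ltr_pdivlMr// mulrC.
(* Utilization is [bound] times [r * D], so comparing it with [bound] amounts to comparing [r * D]
   with 1. *)
have utilD r : (r * kappa / mu = r * D * bound)%R.
  by rewrite boundE; field; rewrite !gt_eqF//.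
have bound_gt0 : (0 < bound)%R.
  by rewrite boundE; exact: divr_gt0 (divr_gt0 kappa_gt0 mu_gt0) D_gt0.
have quotE : kappa%:E * 'E_P[Q i n] / EDelta = bound%:E.
  by rewrite /EDelta EDE EQ inver gt_eqF// boundE -!EFinM.
have EDltE : lambda%:E * EDelta < 1 <-> (lambda * D < 1)%R.
  by rewrite /EDelta EDE -EFinM lte_fin.
split => //.
- exact: utilE.
- exact: iff_trans (stableE _ _ lambda_gt0 hA) (iff_sym EDltE).
- apply: (iff_trans EDltE); rewrite quotE /rho utilE lte_fin utilD.
  by rewrite -[X in (_ * bound < X)%R]mul1r ltr_pM2r.
apply/le_anti/andP; split.
  apply: ge_ereal_sup => _ [r [B [r0 hB -> /(stableE _ _ r0 hB) rD]]].
  by rewrite utilE lee_fin utilD -[leRHS]mul1r ler_pM2r// ltW.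
(* The value [bound] itself is not stable, so the supremum is approached by [c * bound] for 0 < c <
   1, reached at the rate [c / D]. *)
apply/lee_mul01Pr; first by rewrite lee_fin ltW.
move=> c /andP[c0 c1]; apply: ereal_sup_ubound.
pose r := (c / D)%R.
have r0 : (0 < r)%R by rewrite divr_gt0.
have hr : exponential_arrivals r (scaled_arrivals A (lambda / r)).
  have {1}-> : r = (lambda / (lambda / r))%R by field; rewrite !gt_eqF//.
  exact: exponential_scaled_arrivals (divr_gt0 lambda_gt0 r0).
have rD : (r * D = c)%R by rewrite /r divfK// gt_eqF.
exists r, (scaled_arrivals A (lambda / r)); split => //.
  by rewrite utilE utilD rD -EFinM.
by apply/(stableE _ _ r0 hr); rewrite rD.
Qed.
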